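(* Let $N\ge3$ be an integer and let $[\beta_L,\beta_U]$ be an admissible interval generated by an admissible block $t_1\in\{0,1,\dots,N-1\}$ of length one. Then $\lceil (N-1)/2\rceil\le t_1\le N-2$, and for any $\beta\in[\beta_L,\beta_U]$ $$\dim_H\mathbf{U}_{\beta,N}=\frac{\log(2t_1+2-N)}{\log\beta}.$$
   Context: Fix the integer $N$. Blocks of equal length and infinite sequences over $\{0,1,\dots,N-1\}$ are compared lexicographically. For a digit $c$, $\overline{c}:=N-1-c$, and $\overline{c_1c_2\cdots}:=\overline{c_1}\,\overline{c_2}\cdots$ for blocks and sequences. For a block with $c_p<N-1$, $c_1\cdots c_p^+:=c_1\cdots c_{p-1}(c_p+1)$. $(c_1\cdots c_p)^\infty$ is the periodic sequence repeating the block. For $\beta>1$, a $\beta$-expansion of $x$ is a sequence $(d_i)\in\{0,\dots,N-1\}^\infty$ with $x=\sum_{i\ge1}d_i\beta^{-i}$; $\mathbf{U}_{\beta,N}$ is the set of real $x$ having exactly one $\beta$-expansion. Quasi-greedy expansion: for $\beta\in(1,N]$, $(\alpha_i(\beta))_{i\ge1}$ is the quasi-greedy $\beta$-expansion of $1$: $\alpha_n(\beta)$ is recursively the largest element of $\{0,\dots,N-1\}$ with $\sum_{i=1}^{n}\alpha_i(\beta)\beta^{-i}<1$. Admissible block: $t_1\cdots t_p\in\{0,\dots,N-1\}^p$ is admissible if $t_p<N-1$ and for every $1\le i\le p$: $\overline{t_1\cdots t_p}\le t_i\cdots t_pt_1\cdots t_{i-1}$ and $t_i\cdots t_p^+\,\overline{t_1\cdots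 t_{i-1}}\le t_1\cdots t_p^+$. Generalized Thue-Morse sequence: $(\theta_i)=(\theta_i(t_1\cdots t_p^+))$ is defined by $\theta_1\cdots\theta_p=t_1\cdots t_p^+$ and, for $m\ge0$, $\theta_{2^mp+1}\cdots\theta_{2^{m+1}p}=\overline{\theta_1\cdots\theta_{2^mp}}\,^+$. Admissible interval: $[\beta_L,\beta_U]$ is the admissible interval generated by an admissible block $t_1\cdots t_p$ if $\beta_L,\beta_U\in(1,N]$ satisfy $(\alpha_i(\beta_L))=(t_1\cdots t_p)^\infty$ and $(\alpha_i(\beta_U))=(\theta_i(t_1\cdots t_p^+))$. *)

(* Defs.v *)
From HB Require Import structures.
From mathcomp Require Import all_boot all_order all_algebra.
From mathcomp Require Import all_classical all_reals all_analysis.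
Set Implicit Arguments.
Unset Strict Implicit.
Unset Printing Implicit Defensive.
Import Order.TTheory GRing.Theory Num.Theory.
Import numFieldNormedType.Exports.
Local Open Scope classical_set_scope.
Local Open Scope ring_scope.

(* Digits are natural numbers below N; blocks are [seq nat] and infinite
   sequences are functions [nat -> nat], both indexed from 0, so that index i
   here is index i+1 in the usual notation c_1 c_2 ... *)

Definition block_le (s t : seq nat) : bool :=
  ((s : seqlexi nat) <= (t : seqlexi nat))%O.

Definition digit_refl (N c : nat) : nat := (N.-1 - c)%N.

Definition block_refl (N : nat) (s : seq nat) : seq nat :=
  map (digit_refl N) s.

(* c_1 ... c_(p-1) (c_p + 1); only meant for nonempty s *)
Definition block_plus (s : seq nat) : seq nat := incr_nth s (size s).-1.

Definition periodic (s : seq nat) (i : nat) : nat := nth 0%N s (i %% size s).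

(* [rot i t] is t_(i+1) ... t_p t_1 ... t_i. *)
Definition admissible_block (N : nat) (t : seq nat) : Prop :=
  [/\ (0 < size t)%N,
      all (fun c => c < N)%N t,
      (last 0 t < N.-1)%N &
      forall i, (i < size t)%N ->
        block_le (block_refl N t) (rot i t) /\
        block_le (block_plus (drop i t) ++ block_refl N (take i t))
                 (block_plus t)].

(* [thue_morse_block N s m] is theta_1 ... theta_(2^m p), where p = size s. *)
Fixpoint thue_morse_block (N : nat) (s : seq nat) (m : nat) : seq nat :=
  if m is m'.+1 then
    thue_morse_block N s m' ++
      block_plus (block_refl N (thue_morse_block N s m'))
  else s.

(* Each block is a prefix of the next one, and the i-th one has length
   2^i p > i when p > 0. *)
Definition thue_morse (N : nat) (s : seq nat) (i : nat) : nat :=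
  nth 0%N (thue_morse_block N s i) i.

Section BetaExpansions.
Variables (R : realType) (N : nat) (beta : R).

Definition is_expansion (d : nat -> nat) (x : R) : Prop :=
  (forall i, (d i < N)%N) /\
  series (fun i => (d i)%:R * beta ^- i.+1) @ \oo --> x.

Definition univoque_set : set R :=
  [set x | exists! d : nat -> nat, is_expansion d x].

Definition quasi_greedy_digit (s : R) (n : nat) : nat :=
  \max_(k < N | s + k%:R * beta ^- n.+1 < 1) k.

Fixpoint quasi_greedy_sum (n : nat) : R :=
  if n is m.+1 then
    quasi_greedy_sum m +
      (quasi_greedy_digit (quasi_greedy_sum m) m)%:R * beta ^- m.+1
  else 0.

Definition quasi_greedy (n : nat) : nat :=
  quasi_greedy_digit (quasi_greedy_sum n) n.

Lemma quasi_greedy_sumE n :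
  quasi_greedy_sum n = \sum_(i < n) (quasi_greedy i)%:R * beta ^- i.+1.
Proof. by elim: n => [|n IH]; rewrite ?big_ord0 // big_ord_recr /= -IH. Qed.

Lemma quasi_greedy_spec : (0 < N)%N -> forall n,
  [/\ (quasi_greedy n < N)%N,
      \sum_(i < n.+1) (quasi_greedy i)%:R * beta ^- i.+1 < 1 &
      forall k, (k < N)%N ->
        \sum_(i < n) (quasi_greedy i)%:R * beta ^- i.+1
          + k%:R * beta ^- n.+1 < 1 ->
        (k <= quasi_greedy n)%N].
Proof.
move=> N0 n.
suff [qN qlt] : (quasi_greedy n < N)%N /\ quasi_greedy_sum n.+1 < 1.
  rewrite -!quasi_greedy_sumE; split=> // k kN klt.
  exact: (@leq_bigmax_cond _ (fun k : 'I_N =>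
    quasi_greedy_sum n + k%:R * beta ^- n.+1 < 1) _ (Ordinal kN)).
have step m : quasi_greedy_sum m < 1 ->
    (quasi_greedy m < N)%N /\ quasi_greedy_sum m.+1 < 1.
  move=> mlt; rewrite /= /quasi_greedy /quasi_greedy_digit.
  pose P (k : 'I_N) := quasi_greedy_sum m + k%:R * beta ^- m.+1 < 1.
  have P0 : (0 < #|P|)%N.
    by apply/card_gt0P; exists (Ordinal N0); rewrite unfold_in /P mul0r addr0.
  have [k Pk ->] := @eq_bigmax_cond _ P (fun k => k : nat) P0.
  by split.
by elim: n => [|n [_ IH]]; apply: step => //=; exact: ltr01.
Qed.

End BetaExpansions.

Definition admissible_interval (R : realType) (N : nat) (t : seq nat)
    (betaL betaU : R) : Prop :=
  [/\ admissible_block N t,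
      1 < betaL <= N%:R,
      1 < betaU <= N%:R,
      quasi_greedy N betaL =1 periodic t &
      quasi_greedy N betaU =1 thue_morse N (block_plus t)].

Section HausdorffDimension.
Variable R : realType.
Local Open Scope ereal_scope.

(* -oo on the empty set *)
Definition diameter (A : set R) : \bar R :=
  ereal_sup [set `|x - y|%:E | x in A & y in A].

(* The empty set counts for 0, also when s = 0; poweR takes 0 ^ 0 = 1. *)
Definition diameter_pow (s : R) (A : set R) : \bar R :=
  if A == set0 then 0 else poweR (diameter A) s.

Definition hausdorff_premeasure (s delta : R) (A : set R) : \bar R :=
  ereal_inf [set \sum_(0 <= i <oo) diameter_pow s (F i) | F in
    [set F : nat -> set R | A `<=` \bigcup_i F i /\
                            forall i, diameter (F i) <= delta%:E]].

(* The premeasure is nonincreasing in delta: the limit at 0+ is a supremum. *)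
Definition hausdorff_measure (s : R) (A : set R) : \bar R :=
  ereal_sup [set hausdorff_premeasure s delta A | delta in
    [set delta : R | (0 < delta)%R]].

Definition hausdorff_dim (A : set R) : \bar R :=
  ereal_inf [set s%:E | s in
    [set s : R | (0 <= s)%R /\ hausdorff_measure s A = 0]].

End HausdorffDimension.

(* Main.v *)
Require Import Defs.
From mathcomp Require Import all_boot all_order all_algebra.
From mathcomp Require Import all_classical all_reals all_analysis.
From mathcomp Require Import zify ring lra.
Import Order.TTheory GRing.Theory Num.Theory.
Import numFieldNormedType.Exports.
Local Open Scope classical_set_scope.
Local Open Scope ring_scope.

(** Write [b = N - 1], [t = t1], [k = 2 t + 2 - N] and let [theta] be the
    Thue-Morse sequence started from [t + 1].  The digits from [b - t] to [t]
    are [k] in number, and the theorem says that for the dimension only the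
    sequences over these middle digits matter.

    The left endpoint of the interval is [t + 1], because a constant
    quasi-greedy expansion [t t t ...] of 1 means [t / (betaL - 1) = 1].

    Lower bound.  For [beta >= t + 1] a tail of middle digits is worth at most
    [t / (beta - 1) <= 1], with strict inequality unless it is constant equal
    to [t]; the same holds after reflection.  So a sequence of middle digits
    ending neither in [t t ...] nor in [(b - t) (b - t) ...] is a unique
    expansion ([middle_univoque]).  Reading such a sequence in base [beta] or,
    after subtracting [b - t] from the digits, in base [k] defines a map onto
    the unit interval minus a countable set.  It is Holder with exponent
    [ln k / ln beta] ([change_base_holder]), so a cover of the univoque set of
    small cost would yield a cover of the unit interval of small Lebesgue
    measure ([holder_cover_measure_neq0]).

    Upper bound.  A unique expansion [d] in a base [beta <= betaU] satisfies
    the lexicographic conditions at [betaU]: tails following a digit below [b]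
    are at most [theta], and reflected tails following a positive digit are at
    most [theta].  Unless [d] is constantly [0] or constantly [b], all late
    tails lie between the reflection of [theta] and [theta].  Such a sequence either has middle
    digits only, or contains the prefix of length 1 of [theta] or its
    reflection.  After the prefix [w] of length [2 ^ m] only two blocks are
    possible: the reflection of [w], and that block with its last digit
    raised, which completes the prefix of length [2 ^ m.+1]
    ([agree_theta_next]).  Hence, for every [M], either the prefix of length
    [2 ^ M] or its reflection shows up, after which [d] is a concatenation of
    blocks taken from a list of four, or [d] is eventually periodic
    ([squeezed_blocks]).  In every case [d] is,
    from some place on, a concatenation of blocks of one length [p] from a
    finite list [L], and the expansions of this kind have measure zero in
    dimension [s] as soon as [size L * beta ^ (- p s) < 1]
    ([block_expansions_content0]).  For [s > ln k / ln beta] this holds for the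
    middle digits ([p = 1], [size L = k]), for periodic tails ([size L = 1]),
    and for the lists of four when [M] is large.  There are countably many
    triples of a starting place, a block length and a list, so the univoque set
    is null in dimension [s]. *)

(** * Digit sequences and partial sums *)

Definition shift_seq (d : nat -> nat) (n i : nat) : nat := d (n + i)%N.

Definition reflect_seq (N : nat) (d : nat -> nat) (i : nat) : nat :=
  digit_refl N (d i).

Section Expansions.
Context {R : realType}.
Implicit Types (beta x y : R) (d e : nat -> nat) (b n m : nat).

Definition psum beta d n : R := \sum_(i < n) (d i)%:R * beta ^- i.+1.

Lemma psum0 beta d : psum beta d 0 = 0.
Proof. by rewrite /psum big_ord0. Qed.

Lemma psumS beta d n :
  psum beta d n.+1 = psum beta d n + (d n)%:R * beta ^- n.+1.
Proof. by rewrite /psum big_ord_recr. Qed.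

Lemma seriesE beta d :
  series (fun i => (d i)%:R * beta ^- i.+1) = psum beta d.
Proof. by apply/funext => n; rewrite /series /= big_mkord. Qed.

Lemma eq_psum beta d e n :
  (forall i, (i < n)%N -> d i = e i) -> psum beta d n = psum beta e n.
Proof. by move=> de; apply: eq_bigr => i _; rewrite de. Qed.

Lemma exprVn1 beta n : 1 < beta -> beta ^- n = beta * beta ^- n.+1.
Proof. by move=> b1; rewrite exprS invfM mulrA divff ?mul1r//; lra. Qed.

Lemma expVn_gt0 beta n : 1 < beta -> 0 < beta ^- n.
Proof. by move=> b1; rewrite invr_gt0 exprn_gt0//; lra. Qed.

Lemma psumD beta d n m :
  psum beta d (n + m) = psum beta d n + beta ^- n * psum beta (shift_seq d n) m.
Proof.
elim: m => [|m IH]; first by rewrite addn0 psum0 mulr0 addr0.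
rewrite addnS !psumS IH mulrDr addrA; congr (_ + _).
by rewrite /shift_seq -addnS exprD invfM; ring.
Qed.

Lemma tail_const_eq beta b : 1 < beta ->
  b%:R / (beta - 1) * beta = b%:R + b%:R / (beta - 1).
Proof. by move=> b1; field; lra. Qed.

(** The largest value compatible with the first [n] digits never increases
    with [n]. *)
Lemma psum_tail_step beta b d n : 1 < beta -> (forall i, (d i <= b)%N) ->
  psum beta d n.+1 + b%:R / (beta - 1) * beta ^- n.+1 <=
  psum beta d n + b%:R / (beta - 1) * beta ^- n.
Proof.
move=> b1 db; rewrite psumS -addrA lerD2l -mulrDl (exprVn1 _ n)// mulrA.
by rewrite tail_const_eq// ler_pM2r ?expVn_gt0// lerD2r ler_nat.
Qed.

Lemma psum_tail beta b d n m : 1 < beta -> (forall i, (d i <= b)%N) ->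
  psum beta d (n + m) + b%:R / (beta - 1) * beta ^- (n + m) <=
  psum beta d n + b%:R / (beta - 1) * beta ^- n.
Proof.
move=> b1 db; elim: m => [|m IH]; first by rewrite addn0.
by apply: le_trans IH; rewrite addnS psum_tail_step.
Qed.

Lemma psum_nondecreasing beta d : 1 < beta -> nondecreasing_seq (psum beta d).
Proof.
move=> b1; apply/nondecreasing_seqP => n.
by rewrite psumS lerDl mulr_ge0// ltW// expVn_gt0.
Qed.

Lemma tail_const_ge0 beta b : 1 < beta -> 0 <= b%:R / (beta - 1).
Proof. by move=> b1; rewrite divr_ge0//; lra. Qed.

Lemma psum_upper beta b d n m : 1 < beta -> (forall i, (d i <= b)%N) ->
  psum beta d m <= psum beta d n + b%:R / (beta - 1) * beta ^- n.
Proof.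
move=> b1 db; have cn j : 0 <= b%:R / (beta - 1) * beta ^- j.
  by rewrite mulr_ge0 ?tail_const_ge0// ltW// expVn_gt0.
have [nm|mn] := leqP n m.
  rewrite -(subnKC nm); apply: le_trans (psum_tail _ _ _ n (m - n) b1 db).
  by rewrite lerDl.
apply: le_trans (psum_nondecreasing _ d b1 _ _ (ltnW mn)) _.
by rewrite lerDl.
Qed.

Lemma cvg_expVn beta : 1 < beta -> (fun n => beta ^- n : R) @ \oo --> (0 : R).
Proof.
move=> b1; under eq_fun do rewrite -exprVn.
apply: cvg_expr; rewrite ger0_norm ?invr_ge0 ?invf_lt1//; lra.
Qed.

(** Replaces the limit in the definition of an expansion by inequalities
    between partial sums, the form in which expansions are used below. *)
Lemma expansionP beta b d x : 1 < beta ->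
  is_expansion b.+1 beta d x <->
  (forall i, (d i <= b)%N) /\
  (forall n, psum beta d n <= x <= psum beta d n + b%:R / (beta - 1) * beta ^- n).
Proof.
move=> b1; rewrite /is_expansion seriesE; split=> -[db cv]; split=> //.
  move=> n; apply/andP; split.
    rewrite -(cvg_lim (@Rhausdorff R) cv); apply: nondecreasing_cvgn_le.
      exact: psum_nondecreasing.
    by apply/cvg_ex; exists x.
  rewrite -(cvg_lim (@Rhausdorff R) cv); apply: limr_le.
    by apply/cvg_ex; exists x.
  by apply: nearW => m; exact: psum_upper.
apply: (@squeeze_cvgr _ _ _ _ (fun n => x - b%:R / (beta - 1) * beta ^- n) (cst x)).
- apply: nearW => n /=; have /andP[h1 h2] := cv n.
  by rewrite h1 andbT lerBlDr.
- rewrite -[X in _ --> X]subr0; apply: cvgB; first exact: cvg_cst.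
  rewrite -[X in _ --> X](mulr0 (b%:R / (beta - 1))); apply: cvgMr.
  exact: cvg_expVn.
- exact: cvg_cst.
Qed.

Lemma psum_first_difference beta d e n : 1 < beta ->
  (forall i, (i < n)%N -> d i = e i) -> (d n < e n)%N ->
  psum beta d n.+1 + beta ^- n.+1 <= psum beta e n.+1.
Proof.
move=> b1 de lt; rewrite !psumS (eq_psum _ _ _ _ de) -addrA lerD2l.
rewrite -[X in _ + X]mul1r -mulrDl ler_pM2r ?expVn_gt0//.
by rewrite natr1 ler_nat.
Qed.

End Expansions.

(** * Existence and uniqueness of expansions *)

Section UniqueExpansions.
Context {R : realType}.
Implicit Types (beta x y : R) (d e : nat -> nat) (b n m : nat).

Lemma expansion_unique_value {beta N d x y} :
  is_expansion N beta d x -> is_expansion N beta d y -> x = y.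
Proof.
by move=> [_ dx] [_ dy]; apply: (cvg_unique (@Rhausdorff R) dx dy).
Qed.

Lemma expansion_cvg beta b d : 1 < beta -> (forall i, (d i <= b)%N) ->
  exists x, is_expansion b.+1 beta d x.
Proof.
move=> b1 db; exists (limn (psum beta d)); split; first exact: db.
rewrite seriesE; apply: nondecreasing_is_cvgn.
  exact: psum_nondecreasing.
exists (psum beta d 0 + b%:R / (beta - 1) * beta ^- 0) => _ [n _ <-].
exact: psum_upper.
Qed.

Lemma expansion_widen b b' beta d x : (b <= b')%N ->
  is_expansion b.+1 beta d x -> is_expansion b'.+1 beta d x.
Proof.
by move=> bb [db cv]; split=> // i; rewrite ltnS (leq_trans _ bb)// -ltnS.
Qed.

Lemma expansion_ge0 b beta d x : 1 < beta -> is_expansion b.+1 beta d x ->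
  0 <= x.
Proof. by move=> b1 /expansionP[//|_ /(_ 0%N)]; rewrite psum0 => /andP[]. Qed.

Lemma expansion_le b beta d x : 1 < beta -> is_expansion b.+1 beta d x ->
  x <= b%:R / (beta - 1).
Proof.
by move=> b1 /expansionP[//|_ /(_ 0%N)]; rewrite psum0 add0r expr0 invr1 mulr1 => /andP[].
Qed.

Lemma expansion_shift {b beta d x} n : 1 < beta ->
  is_expansion b.+1 beta d x ->
  is_expansion b.+1 beta (shift_seq d n) (beta ^+ n * (x - psum beta d n)).
Proof.
move=> b1 /expansionP[//|db xb]; apply/expansionP => //; split.
  by move=> i; exact: db.
have bn : 0 < beta ^+ n by rewrite exprn_gt0//; lra.
move=> m; have := xb (n + m)%N; rewrite psumD exprD invfM => /andP[h1 h2].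
rewrite -(ler_pM2l (expVn_gt0 _ n b1)) -[X in _ && X](ler_pM2l (expVn_gt0 _ n b1)).
rewrite !mulrA mulVf ?gt_eqF// mul1r mulrDr.
by apply/andP; split; lra.
Qed.

Lemma expansion_cat {b beta d e y} n : 1 < beta ->
  (forall i, (i < n)%N -> (d i <= b)%N) -> is_expansion b.+1 beta e y ->
  is_expansion b.+1 beta (fun i => if (i < n)%N then d i else e (i - n)%N)
    (psum beta d n + beta ^- n * y).
Proof.
move=> b1 db /expansionP[//|eb yb]; set f := fun i => _.
have fd : psum beta d n = psum beta f n.
  by apply: eq_psum => i ilt; rewrite /f ilt.
have fe : shift_seq f n = e.
  by apply/funext => i; rewrite /shift_seq /f ltnNge leq_addr /= addKn.
have fb i : (f i <= b)%N by rewrite /f; case: ltnP => // /db.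
apply/expansionP => //; split => // m; rewrite fd.
have [mn|nm] := leqP m n.
  apply/andP; split.
    apply: le_trans (psum_nondecreasing _ _ b1 _ _ mn) _.
    rewrite lerDl mulr_ge0 ?(ltW (expVn_gt0 _ _ b1))//.
    by have := yb 0%N; rewrite psum0 => /andP[].
  rewrite -(subnKC mn); apply: le_trans (psum_tail _ _ _ m (n - m) b1 fb).
  rewrite lerD2l mulrC ler_wpM2r ?(ltW (expVn_gt0 _ _ b1))//.
  by have := yb 0%N; rewrite psum0 expr0 invr1 add0r mulr1 => /andP[].
rewrite -(subnKC (ltnW nm)) psumD fe exprD invfM.
rewrite mulrCA -addrA -mulrDr !lerD2l !ler_pM2l ?expVn_gt0//.
Qed.

Lemma psum_reflect b beta d n : 1 < beta -> (forall i, (d i <= b)%N) ->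
  psum beta (reflect_seq b.+1 d) n =
  b%:R / (beta - 1) * (1 - beta ^- n) - psum beta d n.
Proof.
move=> b1 db; elim: n => [|n IH].
  by rewrite !psum0 expr0 invr1 subrr mulr0 subr0.
rewrite !psumS IH /reflect_seq /digit_refl /= natrB// (exprVn1 _ n)//.
by field; rewrite expf_neq0//; lra.
Qed.

Lemma expansion_reflect {b beta d x} : 1 < beta ->
  is_expansion b.+1 beta d x ->
  is_expansion b.+1 beta (reflect_seq b.+1 d) (b%:R / (beta - 1) - x).
Proof.
move=> b1 /expansionP[//|db xb]; apply/expansionP => //; split.
  by move=> i; rewrite /reflect_seq /digit_refl /= leq_subr.
move=> n; rewrite psum_reflect// mulrBr mulr1.
by have /andP[] := xb n => h1 h2; apply/andP; split; lra.
Qed.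

Lemma reflect_seqK b d : (forall i, (d i <= b)%N) ->
  reflect_seq b.+1 (reflect_seq b.+1 d) = d.
Proof.
by move=> db; apply/funext => i; rewrite /reflect_seq /digit_refl /= subKn.
Qed.

(** One step of the greedy algorithm: the condition [beta <= b.+1] keeps the
    remainder within the range of values that have an expansion. *)
Lemma expansion_step b beta y : 1 < beta -> beta <= b.+1%:R ->
  0 <= y <= b%:R / (beta - 1) ->
  exists2 c, (c <= b)%N & 0 <= beta * y - c%:R <= b%:R / (beta - 1).
Proof.
move=> b1 bN /andP[y0 yb].
have by0 : 0 <= beta * y by rewrite mulr_ge0//; lra.
have := truncn_itv by0; set c := Num.truncn _ => /andP[c1 c2].
have [cb|bc] := leqP c b.
  exists c => //; apply/andP; split; first lra.
  apply: (@le_trans _ _ 1); first by move: c2; rewrite -natr1; lra.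
  rewrite ler_pdivlMr; last lra.
  by move: bN; rewrite -natr1; lra.
exists b => //; apply/andP; split.
  by rewrite subr_ge0 (le_trans _ c1)// ler_nat ltnW.
have : beta * y <= b%:R / (beta - 1) * beta by rewrite mulrC ler_pM2r//; lra.
by rewrite tail_const_eq//; lra.
Qed.

Lemma expansion_exists b beta y : 1 < beta -> beta <= b.+1%:R ->
  0 <= y <= b%:R / (beta - 1) -> exists d, is_expansion b.+1 beta d y.
Proof.
move=> b1 bN yb.
pose I := {y : R | 0 <= y <= b%:R / (beta - 1)}.
have /choice[g gP] : forall z : I, exists cz : nat * I,
    (cz.1 <= b)%N /\ sval cz.2 = beta * sval z - cz.1%:R.
  move=> [z zb]; have [c cb hc] := expansion_step _ _ _ b1 bN zb.
  by exists (c, exist (fun y : R => is_true (0 <= y <= b%:R / (beta - 1))) _ hc).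
pose z n := iter n (fun z => (g z).2)
  (exist (fun y : R => is_true (0 <= y <= b%:R / (beta - 1))) _ yb).
pose d n := (g (z n)).1.
have zS n : sval (z n.+1) = beta * sval (z n) - (d n)%:R.
  by rewrite /z iterS; have [_ ->] := gP (z n).
have yE n : y = psum beta d n + sval (z n) * beta ^- n.
  elim: n => [|n ->]; first by rewrite psum0 expr0 invr1 mulr1 add0r.
  by rewrite psumS zS (exprVn1 _ n)//; ring.
exists d; apply/expansionP => //; split; first by move=> i; have [] := gP (z i).
move=> n; have /andP[h1 h2] := svalP (z n).
rewrite (yE n) lerDl lerD2l ler_pM2r ?expVn_gt0// mulr_ge0//.
by rewrite ltW// expVn_gt0.
Qed.

(** If the tail after position [n] were worth at least 1, one unit could be
    carried into digit [n] and the remainder expanded again. *)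
Lemma univoque_tail_lt1 b beta d x n : 1 < beta -> beta <= b.+1%:R ->
  is_expansion b.+1 beta d x ->
  (forall e, is_expansion b.+1 beta e x -> d = e) ->
  (d n < b)%N -> beta ^+ n.+1 * (x - psum beta d n.+1) < 1.
Proof.
move=> b1 bN dx uniq dn; rewrite ltNge; apply/negP => ge1.
set v := beta ^+ _ * _ in ge1.
have vb := expansion_le _ _ _ _ b1 (expansion_shift n.+1 b1 dx).
have db : forall i, (d i <= b)%N by case: dx.
have [|e ev] := expansion_exists b beta (v - 1) b1 bN.
  apply/andP; split; first lra.
  by apply: le_trans vb; rewrite -/v; lra.
pose d' i := if i == n then (d n).+1 else d i.
have := @expansion_cat b beta d' e _ n.+1 b1 _ ev.
set f := fun i => _.
have -> : psum beta d' n.+1 + beta ^- n.+1 * (v - 1) = x.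
  rewrite psumS {2}/d' eqxx (@eq_psum _ _ d' d n); last first.
    by move=> i; rewrite /d'; case: eqP => // ->; rewrite ltnn.
  have bn0 : beta ^+ n.+1 != 0 by rewrite expf_neq0//; lra.
  by rewrite -natr1 /v psumS mulrBr mulKf//; ring.
move=> H; have /uniq de : is_expansion b.+1 beta f x.
  by apply: H => i _; rewrite /d'; case: eqP.
have := congr1 (@^~ n) de; rewrite /f ltnSn /d' eqxx => /eqP.
by rewrite -[X in X == _]addn0 -addn1 eqn_add2l.
Qed.

(** The sequence that is smaller at the first difference has to make up for at
    least one unit of that digit with its tail. *)
Lemma tail_ge1_of_lt b beta d e x n : 1 < beta ->
  is_expansion b.+1 beta d x -> is_expansion b.+1 beta e x ->
  (forall i, (i < n)%N -> d i = e i) -> (d n < e n)%N ->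
  1 <= beta ^+ n.+1 * (x - psum beta d n.+1).
Proof.
move=> b1 dx ex de lt.
have := expansion_ge0 _ _ _ _ b1 (expansion_shift n.+1 b1 ex).
have := psum_first_difference _ _ _ _ b1 de lt.
have bp : 0 < beta ^+ n.+1 by rewrite exprn_gt0//; lra.
move=> h1; rewrite !mulrBr => h2.
have : beta ^+ n.+1 * (psum beta d n.+1 + beta ^- n.+1) <=
       beta ^+ n.+1 * psum beta e n.+1 by rewrite ler_pM2l.
by rewrite mulrDr divff ?gt_eqF//; lra.
Qed.

Lemma first_difference d e : d <> e ->
  exists2 n, d n != e n & forall i, (i < n)%N -> d i = e i.
Proof.
move=> de; have ex : exists n, d n != e n.
  apply: contrapT => H; apply: de; apply/funext => n.
  by apply/eqP/negPn/negP => dn; apply: H; exists n.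
exists (ex_minn ex); first by case: ex_minnP.
case: ex_minnP => m _ min i im; apply/eqP; apply: contraLR im => /min.
by rewrite -leqNgt.
Qed.

(** An expansion that is larger than [d] at the first difference is excluded by
    the tails of [d], a smaller one by the tails of the reflection of [d]. *)
Lemma unique_of_tails_lt1 b beta d x : 1 < beta ->
  is_expansion b.+1 beta d x ->
  (forall n, beta ^+ n * (x - psum beta d n) < 1) ->
  (forall n, beta ^+ n * (b%:R / (beta - 1) - x -
      psum beta (reflect_seq b.+1 d) n) < 1) ->
  univoque_set b.+1 beta x.
Proof.
move=> b1 dx lt1 rlt1; exists d; split=> // e ex; apply: contrapT => de.
have [n] := first_difference _ _ de; rewrite neq_ltn => /orP[lt|lt] eqn.
  by have := lt1 n.+1; rewrite ltNge (tail_ge1_of_lt b _ _ e).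
have := rlt1 n.+1; rewrite ltNge (tail_ge1_of_lt b _ _ (reflect_seq b.+1 e))//.
- exact: expansion_reflect.
- exact: expansion_reflect.
- by move=> i /eqn; rewrite /reflect_seq => ->.
- case: dx => /(_ n) /= dn _; rewrite /reflect_seq /digit_refl /=; lia.
Qed.

End UniqueExpansions.

(** * The generalized Thue-Morse sequence *)

(** The lexicographic order on infinite sequences, in the form that is
    directly usable: a bound on each digit preceded by a common prefix. *)
Definition lex_le (d e : nat -> nat) : Prop :=
  forall m, (forall i, (i < m)%N -> d i = e i) -> (d m <= e m)%N.

Definition agree (d : nat -> nat) (n p : nat) (e : nat -> nat) : Prop :=
  forall i, (i < p)%N -> d (n + i)%N = e i.

Definition blocks_in (n p : nat) (L : seq (seq nat)) (d : nat -> nat) : Prop :=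
  forall j, mkseq (shift_seq d (n + j * p)) p \in L.

Definition squeezed (N : nat) (theta d : nat -> nat) : Prop :=
  forall n, lex_le (shift_seq d n) theta /\
            lex_le (reflect_seq N (shift_seq d n)) theta.

Section ThueMorse.
Variables (N : nat) (s : seq nat).
Hypothesis s0 : (0 < size s)%N.

Lemma size_block_plus (w : seq nat) : (0 < size w)%N ->
  size (block_plus w) = size w.
Proof. by move=> w0; rewrite size_incr_nth prednK// leqnn. Qed.

Lemma size_thue_morse_block m : size (thue_morse_block N s m) = (2 ^ m * size s)%N.
Proof.
elim: m => [|m IH] /=; first by rewrite mul1n.
rewrite size_cat size_block_plus size_map IH; first by rewrite expnS; lia.
by rewrite muln_gt0 expn_gt0.
Qed.

Lemma nth_thue_morse_block m j i : (i < 2 ^ m * size s)%N ->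
  nth 0%N (thue_morse_block N s (m + j)) i = nth 0%N (thue_morse_block N s m) i.
Proof.
move=> im; elim: j => [|j IH]; first by rewrite addn0.
rewrite addnS /= nth_cat size_thue_morse_block IH.
rewrite (leq_trans im)// leq_mul2r leq_exp2l// leq_addr orbT//.
Qed.

Lemma thue_morseE m i : (i < 2 ^ m * size s)%N ->
  thue_morse N s i = nth 0%N (thue_morse_block N s m) i.
Proof.
move=> im; have ii : (i < 2 ^ i * size s)%N.
  by apply: leq_trans (ltn_expl i (isT : 1 < 2)%N) _; rewrite leq_pmulr.
rewrite /thue_morse; have [le|lt] := leqP i m.
  by have := nth_thue_morse_block i (m - i) i ii; rewrite subnKC.
by have := nth_thue_morse_block m (i - m) i im; rewrite subnKC // ltnW.
Qed.

(** The recursive definition by blocks, read off digit by digit. *)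
Lemma thue_morse_double m i : (i < 2 ^ m * size s)%N ->
  thue_morse N s (2 ^ m * size s + i) =
  ((i == (2 ^ m * size s).-1) + digit_refl N (thue_morse N s i))%N.
Proof.
move=> im; rewrite (thue_morseE m.+1); last by rewrite expnS -mulnA; lia.
rewrite /= nth_cat size_thue_morse_block ltnNge leq_addr /= addKn.
rewrite nth_incr_nth size_map size_thue_morse_block eq_sym (thue_morseE m)//.
by rewrite (nth_map 0%N)// size_thue_morse_block.
Qed.

End ThueMorse.

(** * Sequences between the reflection of [theta] and [theta] *)

Section SqueezedSequences.
Variables (b t : nat).
Hypotheses (bt : (b - t <= t)%N) (tb : (t < b)%N).
Let N := b.+1.
Let theta := thue_morse N [:: t.+1].
Hypothesis theta_le : forall i, (theta i <= b)%N.
Let rtheta := reflect_seq N theta.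

Lemma theta0 : theta 0 = t.+1. Proof. by []. Qed.

Lemma theta_double m i : (i < 2 ^ m)%N ->
  theta (2 ^ m + i)%N = ((i == (2 ^ m).-1) + (b - theta i))%N.
Proof.
have := @thue_morse_double N [:: t.+1] isT m i.
by rewrite muln1; apply.
Qed.

Lemma theta1 : theta 1 = (b - t)%N.
Proof. by have := theta_double 0 0 isT; rewrite /= theta0 => ->; lia. Qed.

(** After the prefix of length [2 ^ m], the comparison with [theta] bounds the
    next block above by the reflected prefix with its last digit raised, and
    the comparison with [rtheta] bounds it below by the reflected prefix. These
    two blocks are lexicographically consecutive, and the larger one completes
    the prefix of length [2 ^ m.+1]. *)
Lemma agree_theta_next d m n : (forall i, (d i <= b)%N) ->
  squeezed N theta d -> agree d n (2 ^ m) theta ->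
  agree d (n + 2 ^ m) (2 ^ m) rtheta \/ agree d n (2 ^ m.+1) theta.
Proof.
move=> db sq ag; set p := (2 ^ m)%N in ag *.
have p0 : (0 < p)%N by rewrite expn_gt0.
have up i : (i < p)%N -> (forall j, (j < i)%N -> d (n + p + j)%N = rtheta j) ->
    (d (n + p + i) <= theta (p + i))%N.
  move=> ip eqi; rewrite -addnA; apply: ((sq n).1 (p + i)%N) => j jpi.
  rewrite /shift_seq; have [jp|pj] := ltnP j p; first exact: ag.
  rewrite -(subnKC pj) addnA eqi; last lia.
  rewrite theta_double -/p; last lia.
  rewrite [_ == _](_ : _ = false)//; apply/eqP; lia.
have down i : (i < p)%N -> (forall j, (j < i)%N -> d (n + p + j)%N = rtheta j) ->
    (rtheta i <= d (n + p + i))%N.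
  move=> ip eqi; have := (sq (n + p)%N).2 i.
  rewrite /reflect_seq /shift_seq /digit_refl /=.
  move=> H; have {}H : (b - d (n + p + i) <= theta i)%N.
    apply: H => j ji; rewrite eqi// /rtheta /reflect_seq /digit_refl /=.
    by rewrite subKn.
  rewrite /rtheta /reflect_seq /digit_refl /=; have := db (n + p + i)%N; lia.
have init i : (i < p.-1)%N -> d (n + p + i)%N = rtheta i.
  elim/ltn_ind: i => i IH ip; have eqi j : (j < i)%N -> d (n + p + j)%N = rtheta j.
    by move=> ji; apply: IH => //; lia.
  have ip' : (i < p)%N by lia.
  have := up i ip' eqi; have := down i ip' eqi.
  rewrite theta_double// -/p ltn_eqF//= add0n /rtheta /reflect_seq /digit_refl /=.
  lia.
have lp : (p.-1 < p)%N by lia.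
have := up _ lp init; have := down _ lp init.
rewrite theta_double// -/p eqxx leq_eqVlt => /orP[/eqP e _|lt le].
  left=> i ip; have [<-|ne] := eqVneq p.-1 i; first by rewrite e.
  by apply: init; lia.
right=> i; rewrite expnS -/p => ip; have [jp|pj] := ltnP i p; first exact: ag.
rewrite -(subnKC pj) addnA; set j := (i - p)%N.
have jp : (j < p)%N by rewrite /j; lia.
rewrite theta_double// -/p; have [->|ne] := eqVneq j p.-1.
  move: lt le; rewrite /rtheta /reflect_seq /digit_refl /=; lia.
by rewrite init//; lia.
Qed.

Lemma squeezed_reflect d : (forall i, (d i <= b)%N) ->
  squeezed N theta d -> squeezed N theta (reflect_seq N d).
Proof.
move=> db sq n; have [le ge] := sq n; split; first exact: ge.
rewrite (_ : reflect_seq N (shift_seq _ _) = shift_seq d n)//.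
by apply: (reflect_seqK b (shift_seq d n)) => i; exact: db.
Qed.

Lemma agree_rtheta_next d m n : (forall i, (d i <= b)%N) ->
  squeezed N theta d -> agree d n (2 ^ m) rtheta ->
  agree d (n + 2 ^ m) (2 ^ m) theta \/ agree d n (2 ^ m.+1) rtheta.
Proof.
move=> db sq ag.
have to_theta p q : agree (reflect_seq N d) p q rtheta -> agree d p q theta.
  move=> h i /h; rewrite /rtheta /reflect_seq /digit_refl /=.
  by have := db (p + i)%N; have := theta_le i; lia.
have to_rtheta p q : agree (reflect_seq N d) p q theta -> agree d p q rtheta.
  move=> h i /h; rewrite /rtheta /reflect_seq /digit_refl /=.
  by have := db (p + i)%N; lia.
have db' i : (reflect_seq N d i <= b)%N by rewrite /reflect_seq leq_subr.
have [|/to_theta|/to_rtheta] := agree_theta_next _ m n db' (squeezed_reflect d db sq);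
  [|by left|by right].
move=> i /ag; rewrite /reflect_seq /rtheta /reflect_seq /digit_refl /= => ->.
by have := theta_le i; lia.
Qed.

Definition theta_block (d : nat -> nat) (m n : nat) : Prop :=
  agree d n (2 ^ m) theta \/ agree d n (2 ^ m) rtheta.

Lemma mkseq_agree d n p e : agree d n p e -> mkseq (shift_seq d n) p = mkseq e p.
Proof.
move=> ag; apply/eq_in_map => i; rewrite mem_iota add0n => /andP[_ ip].
exact: ag.
Qed.

(** If the next larger prefix never shows up, the current prefix and its
    reflection must alternate for ever. *)
Lemma theta_block_climb d m n : (forall i, (d i <= b)%N) ->
  squeezed N theta d -> theta_block d m n ->
  (exists n', theta_block d m.+1 n') \/
  exists n' w, blocks_in n' (2 ^ m.+1) [:: w] d.
Proof.
move=> db sq blk; have [|no] := pselect (exists n', theta_block d m.+1 n').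
  by left.
right; have up n' : agree d n' (2 ^ m) theta -> agree d (n' + 2 ^ m) (2 ^ m) rtheta.
  by move=> /agree_theta_next[]// h; case: no; exists n'; left.
have down n' : agree d n' (2 ^ m) rtheta -> agree d (n' + 2 ^ m) (2 ^ m) theta.
  by move=> /agree_rtheta_next[]// h; case: no; exists n'; right.
have [n' agn'] : exists n', agree d n' (2 ^ m) theta.
  by case: blk => [?|/down ?]; [exists n|exists (n + 2 ^ m)%N].
have agj j : agree d (n' + j * 2 ^ m.+1) (2 ^ m) theta.
  elim: j => [|j /up/down]; first by rewrite addn0.
  by rewrite expnS; congr (agree _ _ _ _); lia.
exists n', (mkseq (fun i =>
  if (i < 2 ^ m)%N then theta i else rtheta (i - 2 ^ m)%N) (2 ^ m.+1)).
move=> j; rewrite inE; apply/eqP/mkseq_agree => i; rewrite expnS => im.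
have [lt|ge] := ltnP i (2 ^ m); first by rewrite -expnS agj.
by rewrite -(up _ (agj j)) ?expnS; [congr d|]; lia.
Qed.

Lemma theta_block_or_periodic d n M : (forall i, (d i <= b)%N) ->
  squeezed N theta d -> theta_block d 0 n ->
  (exists n', theta_block d M n') \/
  exists m n' w, blocks_in n' (2 ^ m.+1) [:: w] d.
Proof.
move=> db sq blk; elim: M => [|M [[n' blk']|]]; [by left; exists n| |by right].
by case: (theta_block_climb _ _ _ db sq blk') => [|?]; [left|right; exists M].
Qed.

(** Once a prefix of length [2 ^ M] or its reflection has been met, only four
    blocks of that length can follow, whatever the size of the alphabet. *)
Lemma theta_block_four d M n : (forall i, (d i <= b)%N) ->
  squeezed N theta d -> theta_block d M n ->
  blocks_in n (2 ^ M)
    [:: mkseq theta (2 ^ M); mkseq rtheta (2 ^ M);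
        mkseq (shift_seq theta (2 ^ M)) (2 ^ M);
        mkseq (shift_seq rtheta (2 ^ M)) (2 ^ M)] d.
Proof.
move=> db sq blk; set p := (2 ^ M)%N; set L := [:: _; _; _; _].
have inL n' : theta_block d M n' -> mkseq (shift_seq d n') p \in L.
  by case=> /mkseq_agree e; rewrite !inE /p e eqxx ?orbT.
have p0 : (0 < p)%N by rewrite expn_gt0.
have next n' : theta_block d M n' -> theta_block d M (n' + p) \/
    (mkseq (shift_seq d (n' + p)) p \in L /\ theta_block d M (n' + p + p)).
  have tail e k : agree d k (2 ^ M.+1) e -> agree d (k + p) p (shift_seq e p).
    by move=> h i ip; rewrite -addnA h// expnS -/p; lia.
  have head e k : agree d k (2 ^ M.+1) e -> agree d k p e.
    by move=> h i ip; rewrite h// expnS -/p; lia.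
  (* The prefix of length [2 ^ M.+2] continues that of length [2 ^ M.+1] by the
     reflection of its first half; the raised last digit lies further on. *)
  have twice i : (i < p)%N -> theta (2 ^ M.+1 + i)%N = rtheta i.
    move=> ip; rewrite theta_double expnS -/p; last lia.
    by rewrite [_ == _](_ : _ = false)//; apply/eqP; lia.
  case=> [/agree_theta_next[]//|/agree_rtheta_next[]//] h.
  - by left; right.
  - right; split.
      by rewrite (mkseq_agree _ _ _ _ (tail _ _ h)) !inE eqxx !orbT.
    have : theta_block d M (n' + 2 ^ M.+1).
      right; case: (agree_theta_next d M.+1 n' db sq h) => [/head//|h2] i ip.
      by rewrite -addnA h2 ?expnS -/p; [rewrite -expnS twice|lia].
    by rewrite expnS -/p; congr theta_block; lia.
  - by left; left.
  - right; split.
      by rewrite (mkseq_agree _ _ _ _ (tail _ _ h)) !inE eqxx !orbT.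
    have : theta_block d M (n' + 2 ^ M.+1).
      left; case: (agree_rtheta_next d M.+1 n' db sq h) => [/head//|h2] i ip.
      rewrite -addnA h2 ?expnS -/p; last lia.
      rewrite -expnS {1}/rtheta /reflect_seq twice// /rtheta /reflect_seq /digit_refl /=.
      by rewrite subKn.
    by rewrite expnS -/p; congr theta_block; lia.
have inv j : theta_block d M (n + j * p) \/
    (mkseq (shift_seq d (n + j * p)) p \in L /\ theta_block d M (n + j * p + p)).
  elim: j => [|j]; first by left; rewrite addn0.
  have -> : (n + j.+1 * p = n + j * p + p)%N by lia.
  by case=> [/next//|[_]]; left.
by move=> j; case: (inv j) => [/inL|[]].
Qed.

(** The first digit of [theta] confines the digits to the range from
    [b - t.+1] to [t.+1], and each of these two extreme digits is a prefix of
    length 1 of [theta] or of [rtheta], from which longer prefixes grow. *)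
Lemma squeezed_blocks d M : (forall i, (d i <= b)%N) -> squeezed N theta d ->
  exists n p L, [/\ (0 < p)%N, blocks_in n p L d &
    [|| (size L <= 1)%N, (p == 1%N) && (size L <= 2 * t + 1 - b)%N
      | (p == 2 ^ M)%N && (size L <= 4)%N]].
Proof.
move=> db sq; have [mid|] := pselect (forall n, (b - t <= d n <= t)%N).
  exists 0%N, 1%N, [seq [:: c] | c <- iota (b - t) (2 * t + 1 - b)].
  split=> //; last by rewrite size_map size_iota eqxx leqnn orbT.
  move=> j; rewrite muln1 add0n /mkseq /= map_f// mem_iota /shift_seq addn0.
  by have := mid j; lia.
move=> /existsNP[n out]; have blk : theta_block d 0 n.
  have [le ge] := sq n.
  have dle : (d n <= t.+1)%N.
    have : (shift_seq d n 0 <= t.+1)%N by apply: (le 0%N).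
    by rewrite /shift_seq addn0.
  have dge : (b - d n <= t.+1)%N.
    have : (reflect_seq N (shift_seq d n) 0 <= t.+1)%N by apply: (ge 0%N).
    by rewrite /reflect_seq /shift_seq addn0.
  have := db n; move: out => /negP out.
  have [dn|ne] := eqVneq (d n) t.+1; [left|right]; case=> // _.
    by rewrite addn0 dn.
  by rewrite addn0 /rtheta /reflect_seq /digit_refl theta0 /=; lia.
case: (theta_block_or_periodic d n M db sq blk) => [[n' blk']|].
  exists n', (2 ^ M)%N; eexists; split; [by rewrite expn_gt0|exact: theta_block_four|].
  by rewrite eqxx orbT.
move=> [m [n' [w per]]]; exists n', (2 ^ m.+1)%N, [:: w].
by split=> //; rewrite expn_gt0.
Qed.

End SqueezedSequences.

(** * Block structure of unique expansions *)

Section FromUnivoque.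
Variables (b t : nat).
Hypotheses (bt : (b - t <= t)%N) (tb : (t < b)%N).
Let N := b.+1.
Let theta := thue_morse N [:: t.+1].
Hypothesis theta_le : forall i, (theta i <= b)%N.

(** A digit [b] that follows a digit below [b] forces the comparison with
    [theta] to be tight at its first digit, and then the second digit of
    [theta], which is smaller than the first, bounds what comes next. *)
Lemma lex_le_tails d n0 : (forall i, (d i <= b)%N) ->
  (forall n, (d n < b)%N -> lex_le (shift_seq d n.+1) theta) ->
  (d n0 < b)%N -> forall n, lex_le (shift_seq d (n0.+1 + n)) theta.
Proof.
move=> db cond lt0; elim=> [|n IH]; first by rewrite addn0; exact: cond.
rewrite addnS; set k := (n0.+1 + n)%N in IH *.
have := db k; rewrite leq_eqVlt => /orP[/eqP dk|]; last exact: cond.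
have k0 : d k = theta 0.
  have : (shift_seq d k 0 <= theta 0)%N by apply: (IH 0%N).
  by rewrite /shift_seq addn0 /theta theta0; lia.
have : (shift_seq d k 1 <= theta 1)%N.
  by apply: (IH 1%N) => -[|//] _; rewrite /shift_seq addn0.
rewrite /shift_seq addn1 /theta theta1// => d1 m eqm.
have dk1 : (d k.+1 < theta 0)%N by rewrite /theta theta0; lia.
case: m eqm => [_|m eqm]; first by rewrite addn0 ltnW.
by have := eqm 0%N isT; rewrite addn0 => e; move: dk1; rewrite e ltnn.
Qed.

(** A digit below [b] and a positive digit occur unless the sequence is
    constant; past both of them, all tails obey both comparisons. *)
Lemma univoque_digits_blocks d M : (forall i, (d i <= b)%N) ->
  (forall n, (d n < b)%N -> lex_le (shift_seq d n.+1) theta) ->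
  (forall n, (0 < d n)%N -> lex_le (reflect_seq N (shift_seq d n.+1)) theta) ->
  exists n p L, [/\ (0 < p)%N, blocks_in n p L d &
    [|| (size L <= 1)%N, (p == 1%N) && (size L <= 2 * t + 1 - b)%N
      | (p == 2 ^ M)%N && (size L <= 4)%N]].
Proof.
move=> db le ge.
have constant c : (forall n, d n = c) -> exists n p L, [/\ (0 < p)%N,
    blocks_in n p L d &
    [|| (size L <= 1)%N, (p == 1%N) && (size L <= 2 * t + 1 - b)%N
      | (p == 2 ^ M)%N && (size L <= 4)%N]].
  move=> dc; exists 0%N, 1%N, [:: [:: c]]; split=> // j.
  by rewrite /mkseq /= /shift_seq dc inE.
have [/constant//|/existsNP[n1 d1]] := pselect (forall n, d n = b).
have [/constant//|/existsNP[n2 d2]] := pselect (forall n, d n = 0%N).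
have {}d1 : (d n1 < b)%N by have := db n1; lia.
have {}d2 : (0 < d n2)%N by lia.
pose rd := reflect_seq N d.
have rdb i : (rd i <= b)%N by rewrite /rd /reflect_seq leq_subr.
have le' := lex_le_tails d n1 db le d1.
have ge' n : lex_le (shift_seq rd (n2.+1 + n)) theta.
  apply: lex_le_tails => // [k|]; rewrite /rd /reflect_seq /digit_refl /=; last lia.
  by move=> dk; apply: (ge k); lia.
pose n0 := (n1.+1 + n2.+1)%N.
have sq : squeezed N theta (shift_seq d n0).
  move=> n; have sE e : shift_seq (shift_seq e n0) n = shift_seq e (n0 + n).
    by apply/funext => i; rewrite /shift_seq addnA.
  split; first by rewrite sE /n0 -addnA; exact: le'.
  have := ge' (n1.+1 + n)%N; rewrite addnA (addnC n2.+1) -/n0 /rd -sE.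
  by apply.
have [|n [p [L [p0 blk sz]]]] := squeezed_blocks b t bt tb theta_le _ M _ sq.
  by move=> i; exact: db.
exists (n0 + n)%N, p, L; split=> // j; have := blk j.
by rewrite (_ : shift_seq (shift_seq _ _) _ = shift_seq d (n0 + n + j * p))//;
  apply/funext => i; rewrite /shift_seq; congr d; lia.
Qed.

Context {R : realType}.

Lemma psum_antitone (beta gamma : R) d n : 1 < beta -> beta <= gamma ->
  psum gamma d n <= psum beta d n.
Proof.
move=> b1 bg; apply: ler_sum => i _; rewrite ler_wpM2l// lef_pV2 ?posrE.
- by rewrite lerXn2r// nnegrE; lra.
- by rewrite exprn_gt0//; lra.
- by rewrite exprn_gt0//; lra.
Qed.

(** Raising a digit of the quasi-greedy expansion of 1 in a larger base
    [gamma] pushes the partial sum to 1 or above, in base [gamma] and hence in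
    base [beta]. *)
Lemma lex_le_of_lt1 (beta gamma : R) e y : 1 < beta -> beta <= gamma ->
  is_expansion N beta e y -> y < 1 -> lex_le e (quasi_greedy N gamma).
Proof.
move=> b1 bg ey y1 m agr; rewrite leqNgt; apply/negP => lt.
have eb : (e m < N)%N by case: ey.
have [_ _ /(_ (e m) eb)] := @quasi_greedy_spec R N gamma isT m.
rewrite leqNgt lt => H; suff : false by []; apply: H.
have -> : \sum_(i < m) (quasi_greedy N gamma i)%:R / gamma ^+ i.+1 = psum gamma e m.
  by apply: eq_bigr => i _; rewrite agr.
rewrite -psumS; apply: le_lt_trans (psum_antitone _ _ _ _ b1 bg) _.
apply: le_lt_trans y1; move/(expansionP _ _ _ _ b1) : ey => [_ /(_ m.+1)].
by case/andP.
Qed.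

Lemma univoque_blocks (beta betaU : R) d x M : 1 < beta -> beta <= betaU ->
  betaU <= N%:R -> quasi_greedy N betaU =1 theta ->
  is_expansion N beta d x -> (forall e, is_expansion N beta e x -> d = e) ->
  exists n p L, [/\ (0 < p)%N, blocks_in n p L d &
    [|| (size L <= 1)%N, (p == 1%N) && (size L <= 2 * t + 1 - b)%N
      | (p == 2 ^ M)%N && (size L <= 4)%N]].
Proof.
move=> b1 bU UN /funext qg dx uniq.
have bN : beta <= b.+1%:R by exact: le_trans UN.
have db i : (d i <= b)%N by case: dx => /(_ i).
have rx := expansion_reflect b1 dx.
have runiq e : is_expansion N beta e (b%:R / (beta - 1) - x) -> reflect_seq N d = e.
  move=> ex; have eb i : (e i <= b)%N by case: ex => /(_ i).
  rewrite -[RHS](reflect_seqK b)//; congr reflect_seq; apply: uniq.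
  by have := expansion_reflect b1 ex; rewrite opprB addrC subrK.
apply: univoque_digits_blocks => // n dn; rewrite -qg.
  apply: (lex_le_of_lt1 beta betaU _ _ b1 bU (expansion_shift n.+1 b1 dx)).
  exact: (univoque_tail_lt1 b).
apply: (lex_le_of_lt1 beta betaU _ _ b1 bU (expansion_shift n.+1 b1 rx)).
apply: (univoque_tail_lt1 b) => //.
by rewrite /reflect_seq /digit_refl /=; have := db n; lia.
Qed.

End FromUnivoque.

(** * Null sets for the Hausdorff measure *)

Section NullSets.
Context {R : realType}.
Local Open Scope ereal_scope.
Implicit Types (s : R) (A : set R).

Lemma diameter_ge0 A : A !=set0 -> 0 <= diameter A.
Proof.
move=> [x Ax]; apply: ereal_sup_ubound; exists x => //; exists x => //.
by rewrite subrr normr0.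
Qed.

Lemma diameter_pow0 s : diameter_pow s (set0 : set R) = 0.
Proof. by rewrite /diameter_pow eqxx. Qed.

Lemma diameter_pow_ge0 s A : 0 <= diameter_pow s A.
Proof. by rewrite /diameter_pow; case: ifP => // _; exact: poweR_ge0. Qed.

Lemma diameter_pow_le s A (r : R) : (0 < s)%R -> (0 <= r)%R ->
  diameter A <= r%:E -> diameter_pow s A <= (r `^ s)%R%:E.
Proof.
move=> s0 r0 Ar; rewrite /diameter_pow; case: ifPn => [_|/set0P A0].
  by rewrite lee_fin powR_ge0.
rewrite -poweR_EFin; apply: gt0_ler_poweR => //; first exact: ltW.
- by rewrite in_itv /= diameter_ge0//= leey.
- by rewrite in_itv /= lee_fin r0 leey.
Qed.

Lemma diameter_le_of_pow s A (r : R) : (0 < s)%R -> (0 <= r)%R ->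
  diameter_pow s A < (r `^ s)%R%:E -> diameter A <= r%:E.
Proof.
move=> s0 r0; rewrite leNgt /diameter_pow => lt; apply/negP => gt.
move: lt; case: ifPn => [/eqP A0 _|/set0P A0].
  move: gt; rewrite A0 /diameter (_ : [set _ | _ in _ & _ in _] = set0).
    by rewrite ereal_sup0.
  by apply/seteqP; split=> // x [? []].
rewrite ltNge -poweR_EFin gt0_ler_poweR//.
- exact: ltW.
- by rewrite in_itv /= lee_fin r0 leey.
- by rewrite in_itv /= diameter_ge0//= leey.
- exact: ltW.
Qed.

(** The outer measure built from [diameter ^ s] on Borel covers, without any
    bound on the diameters; for [0 < s] it has the same null sets as the
    Hausdorff measure, because a cover of small cost has small diameters. *)
Definition hausdorff_content s : set (measurableTypeR R) -> \bar R :=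
  mu_ext (diameter_pow s : set (measurableTypeR R) -> \bar R).

Lemma hausdorff_content0_bigcup s (A : nat -> set R) :
  (forall i, hausdorff_content s (A i) = 0) ->
  hausdorff_content s (\bigcup_i A i) = 0.
Proof.
move=> A0; apply/eqP; rewrite eq_le (@mu_ext_ge0 _ _ _ _ (diameter_pow_ge0 s)) andbT.
rewrite (le_trans (@mu_ext_sigma_subadditive _ _ _ _ (diameter_pow_ge0 s) A))//.
by rewrite eseries0// => i _ _; exact: A0.
Qed.

Lemma hausdorff_content0_subset s A B : A `<=` B ->
  hausdorff_content s B = 0 -> hausdorff_content s A = 0.
Proof.
move=> AB B0; apply/eqP; rewrite eq_le (@mu_ext_ge0 _ _ _ _ (diameter_pow_ge0 s)) andbT.
by rewrite -B0; exact: le_mu_ext.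
Qed.

Lemma hausdorff_measure_eq0 s A : (0 < s)%R ->
  hausdorff_content s A = 0 -> hausdorff_measure s A = 0.
Proof.
move=> s0 A0; suff pre (delta : R) : (0 < delta)%R ->
    hausdorff_premeasure s delta A = 0.
  apply/eqP; rewrite eq_le; apply/andP; split.
    by apply: ge_ereal_sup => _ [delta /= /pre -> <-].
  by apply: ereal_sup_ubound; exists 1%R => //=; exact: pre.
move=> d0; apply/eqP; rewrite eq_le; apply/andP; split; last first.
  apply: le_ereal_inf_tmp => _ [F _ <-].
  by apply: nneseries_ge0 => i _ _; exact: diameter_pow_ge0.
apply/lee_addgt0Pr => e e0; rewrite add0e.
pose m : R := Num.min e (delta `^ s)%R.
have m0 : (0 < m)%R by rewrite lt_min e0 powR_gt0.
have : hausdorff_content s A < m%:E by rewrite A0 lte_fin.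
move=> /ereal_inf_lt[_ [F [mF AF] <-]] lt.
have ge i : diameter_pow s (F i) <= \sum_(0 <= k <oo) diameter_pow s (F k).
  apply: le_trans (nneseries_lim_ge i.+1 (fun n _ _ => diameter_pow_ge0 s (F n))).
  by rewrite big_nat_recr//= leeDr// sume_ge0// => ? _; exact: diameter_pow_ge0.
apply: (@le_trans _ _ (\sum_(0 <= k <oo) diameter_pow s (F k))).
  apply: ereal_inf_lbound; exists F => //; split => // i.
  apply: (diameter_le_of_pow s _ _ s0 (ltW d0)).
  apply: le_lt_trans (ge i) _; apply: lt_le_trans lt _.
  by rewrite lee_fin ge_min lexx orbT.
by rewrite (le_trans (ltW lt))// lee_fin ge_min lexx.
Qed.

Lemma hausdorff_dim_le A (s0 : R) : (0 <= s0)%R ->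
  (forall s, (s0 < s)%R -> hausdorff_measure s A = 0) ->
  hausdorff_dim A <= s0%:E.
Proof.
move=> s00 null; apply/lee_addgt0Pr => e e0; apply: ereal_inf_lbound.
exists (s0 + e)%R => //; split; first by rewrite addr_ge0// ltW.
by apply: null; rewrite ltrDl.
Qed.

Lemma diameter_itvcc (v r : R) : diameter [set` `[v, v + r]%R] <= r%:E.
Proof.
apply: ge_ereal_sup => _ [x /= + [y /= + <-]].
rewrite !in_itv /= lee_fin => /andP[x1 x2] /andP[y1 y2].
by rewrite ler_norml; apply/andP; split; lra.
Qed.

Lemma hausdorff_content_le s A (V : seq R) (r : R) : (0 < s)%R -> (0 <= r)%R ->
  (forall x, A x -> exists2 v, v \in V & (v <= x <= v + r)%R) ->
  hausdorff_content s A <= ((size V)%:R * r `^ s)%R%:E.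
Proof.
move=> s0 r0 cov.
pose F i : set R := if (i < size V)%N then [set` `[V`_i, V`_i + r]%R] else set0.
apply: (@le_trans _ _ (\sum_(0 <= k <oo) diameter_pow s (F k))).
  apply: ereal_inf_lbound; exists F => //; split.
    move=> i; rewrite /F; case: ifP => _; last exact: measurable0.
    exact: measurable_itv.
  move=> x /cov[v vV xv]; exists (index v V) => //.
  by rewrite /F index_mem vV /= in_itv /= nth_index.
rewrite (nneseries_split 0 (size V)); last by move=> ? _; exact: diameter_pow_ge0.
rewrite add0n eseries0; last first.
  by move=> i; rewrite leqNgt /F => /negbTE -> _; exact: diameter_pow0.
rewrite adde0 mulr_natl -[size V in leRHS]subn0 -sumr_const_nat -sumEFin.
rewrite !big_seq; apply: lee_sum => i; rewrite mem_index_iota => /andP[_ iV].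
rewrite /F iV; apply: diameter_pow_le => //; exact: diameter_itvcc.
Qed.

End NullSets.

Section BlockCovers.
Context {R : realType}.
Variables (beta : R) (b : nat).
Hypothesis b1 : 1 < beta.

Definition block_expansions (n p : nat) (L : seq (seq nat)) : set R :=
  [set x | exists2 d, is_expansion b.+1 beta d x & blocks_in n p L d].

Lemma block_psums n p L j : exists V : seq R,
  (size V <= b.+1 ^ n * size L ^ j)%N /\
  forall d, (forall i, (d i <= b)%N) -> blocks_in n p L d ->
    psum beta d (n + j * p) \in V.
Proof.
elim: j => [|j [V [szV inV]]]; last first.
  exists [seq v + beta ^- (n + j * p) * psum beta (nth 0%N w) p | v <- V, w <- L].
  split.
    by rewrite size_allpairs (leq_trans (leq_mul szV (leqnn _)))// expnSr mulnA.
  move=> d db dL; rewrite mulSn addnCA addnC psumD.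
  apply/allpairsP; exists (psum beta d (n + j * p),
    mkseq (shift_seq d (n + j * p)) p); split => //=; first exact: inV.
  congr (_ + _ * _); apply: eq_psum => i ip.
  by rewrite nth_mkseq.
suff [V [szV inV]] : exists V : seq R, (size V <= b.+1 ^ n)%N /\
    forall d, (forall i, (d i <= b)%N) -> psum beta d n \in V.
  exists V; split; first by rewrite expn0 muln1.
  by move=> d db _; rewrite mul0n addn0; exact: inV.
elim: n => [|n [V [szV inV]]].
  by exists [:: 0]; split=> // d _; rewrite psum0 inE.
exists [seq v + (c%:R : R) * beta ^- n.+1 | v <- V, c <- iota 0 b.+1]; split.
  by rewrite size_allpairs size_iota expnSr leq_mul.
move=> d db; rewrite psumS; apply/allpairsP; exists (psum beta d n, d n).
by split=> //; [exact: inV|rewrite mem_iota add0n /= ltnS db].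
Qed.

Lemma geometric_lt (a q e : R) : 0 <= q < 1 -> 0 < e -> exists j, a * q ^+ j < e.
Proof.
move=> /andP[q0 q1] e0.
have : a * q ^+ j @[j --> \oo] --> a * 0.
  by apply: cvgMr; apply: cvg_expr; rewrite ger0_norm.
rewrite mulr0 => /cvgr_lt /(_ _ e0) [j _ H]; exists j; exact: (H j (leqnn j)).
Qed.

(** At most [b.+1 ^ n * size L ^ j] intervals cover the set, each of length
    proportional to [beta ^- (n + j * p)]. *)
Lemma block_expansions_content0 (s : R) n p L : 0 < s ->
  (size L)%:R * (beta ^- p) `^ s < 1 ->
  hausdorff_content s (block_expansions n p L) = 0%E.
Proof.
move=> s0 small; apply/eqP; rewrite eq_le.
rewrite (@mu_ext_ge0 _ _ _ _ (diameter_pow_ge0 s)) andbT.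
apply/lee_addgt0Pr => e e0; rewrite add0e.
pose C : R := b%:R / (beta - 1) * beta ^- n.
have C0 : 0 <= C.
  by rewrite mulr_ge0 ?tail_const_ge0// ltW// expVn_gt0.
pose q := (size L)%:R * (beta ^- p) `^ s.
have q01 : 0 <= q < 1 by rewrite small andbT mulr_ge0// powR_ge0.
have [j lt] := geometric_lt ((b.+1 ^ n)%:R * C `^ s) _ _ q01 e0.
have [V [szV inV]] := block_psums n p L j.
have r0 : 0 <= C * beta ^- (j * p) by rewrite mulr_ge0// ltW// expVn_gt0.
apply: le_trans (@hausdorff_content_le _ s _ V _ s0 r0 _) _.
  move=> x [d dx dL]; exists (psum beta d (n + j * p)).
    by apply: inV => // i; case: dx => /(_ i).
  move/(expansionP _ _ _ _ b1) : dx => [_ /(_ (n + j * p)%N)].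
  by rewrite exprD invfM mulrA.
rewrite lee_fin (le_trans _ (ltW lt))// powRM// ?(ltW (expVn_gt0 _ _ b1))//.
have -> : (beta ^- (j * p)) `^ s = ((beta ^- p) `^ s) ^+ j.
  rewrite mulnC exprM -exprVn; set y := beta ^- p.
  have y0 : 0 <= y by rewrite ltW// expVn_gt0.
  by rewrite -(powR_mulrn j y0) powRAC powR_mulrn// powR_ge0.
rewrite /q exprMn; set y := (beta ^- p) `^ s.
rewrite [leRHS](_ : _ = ((b.+1 ^ n)%:R * (size L)%:R ^+ j) * (C `^ s * y ^+ j));
  last by ring.
rewrite ler_wpM2r// ?mulr_ge0 ?exprn_ge0 ?powR_ge0//.
by rewrite -natrX -natrM ler_nat.
Qed.

End BlockCovers.

(** * Upper bound for the dimension *)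

Section UpperBound.
Context {R : realType}.
Implicit Types (beta s : R).

Lemma log_base_ge0 beta (k : nat) : 1 < beta -> (0 < k)%N ->
  0 <= ln k%:R / ln beta.
Proof.
by move=> b1 k0; rewrite divr_ge0// ln_ge0//; [rewrite ler1n|exact: ltW].
Qed.

Lemma powR_log_base beta (k : nat) : 1 < beta -> (0 < k)%N ->
  beta `^ (ln k%:R / ln beta) = k%:R.
Proof.
move=> b1 k0; have bn0 : beta != 0 by lra.
rewrite /powR (negbTE bn0) divfK ?lnK// ?posrE ?ltr0n//.
by rewrite gt_eqF// ln_gt0.
Qed.

Lemma powR_expVn beta s p : 1 < beta -> (beta ^- p) `^ s = ((beta `^ s) ^- p).
Proof.
move=> b1; have y0 : 0 <= beta by lra.
by rewrite -(powR_invn p y0) -(powR_invn p (powR_ge0 beta s)) powRAC.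
Qed.

(** Above the critical exponent every type of block list occurring in
    univoque sequences gives a null set; the exponent [M] is taken so large
    that four choices per [2 ^ M] digits cost nothing. *)
Lemma univoque_content0 b t (beta betaU s : R) :
  (b - t <= t)%N -> (0 < t < b)%N ->
  (forall i, (thue_morse b.+1 [:: t.+1] i <= b)%N) ->
  quasi_greedy b.+1 betaU =1 thue_morse b.+1 [:: t.+1] ->
  1 < beta -> beta <= betaU -> betaU <= b.+1%:R ->
  ln (2 * t + 1 - b)%:R / ln beta < s ->
  hausdorff_content s (univoque_set b.+1 beta) = 0%E.
Proof.
move=> bt /andP[t0 tb] theta_le qg b1 bU UN sgt.
set k := (2 * t + 1 - b)%N in sgt; have k0 : (0 < k)%N by rewrite /k; lia.
have s0 : 0 < s by apply: le_lt_trans sgt; exact: log_base_ge0.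
have ks : k%:R < beta `^ s.
  rewrite -(powR_log_base _ _ b1 k0) /powR gt_eqF ?(lt_trans _ b1)//.
  by rewrite ltr_expR ltr_pM2r// ln_gt0.
have bs1 : 1 < beta `^ s by apply: le_lt_trans ks; rewrite ler1n.
(* The bound for [M] comes from [2 ^ M >= M]. *)
have [M M4] : exists M, 4 * (beta `^ s) ^- (2 ^ M) < 1.
  have q01 : 0 <= (beta `^ s)^-1 < 1.
    by rewrite invr_ge0 powR_ge0 invf_lt1//; lra.
  have [j] := geometric_lt 4 _ 1 q01 ltr01; rewrite exprVn => lt; exists j.
  apply: le_lt_trans lt; rewrite ler_pM2l// lef_pV2 ?posrE ?exprn_gt0//; try lra.
  by rewrite ler_eXn2l// ltnW// ltn_expl.
pose null (c : nat * nat * seq (seq nat)) :=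
  (size c.2)%:R * (beta ^- c.1.2) `^ s < 1 :> R.
(* Indexing by all triples makes the union countable without describing which
   lists occur. *)
pose A i : set R := if unpickle i is Some c then
  if null c then block_expansions beta b c.1.1 c.1.2 c.2 else set0 else set0.
apply: (@hausdorff_content0_subset _ s _ (\bigcup_i A i)); last first.
  have null0 : hausdorff_content s (set0 : set R) = 0%E.
    exact: (mu_ext0 (diameter_pow0 s) (diameter_pow_ge0 s)).
  apply: hausdorff_content0_bigcup => i; rewrite /A.
  case: unpickle => // -[[n p] L]; case: ifP => // nc.
  exact: block_expansions_content0.
move=> x [d [dx uniq]].
have [n [p [L [p0 blk sz]]]] :=
  univoque_blocks b t bt tb theta_le beta betaU d x M b1 bU UN qg dx uniq.
exists (pickle (n, p, L)) => //; rewrite /A pickleK.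
suff -> : null (n, p, L) by exists d.
rewrite /null /= powR_expVn//.
have le_size (m : nat) : (size L <= m)%N ->
    (size L)%:R * (beta `^ s) ^- p <= m%:R * (beta `^ s) ^- p.
  by move=> ?; rewrite ler_wpM2r ?ler_nat// ltW// expVn_gt0.
case/or3P: sz => [/le_size|/andP[/eqP p1 /le_size]|/andP[/eqP pM /le_size]] le.
- apply: le_lt_trans le _; rewrite mul1r invf_lt1 ?exprn_gt0//; last lra.
  by rewrite exprn_egt1// -lt0n.
- apply: le_lt_trans le _; rewrite p1 expr1 ltr_pdivrMr ?mul1r//; lra.
- by apply: le_lt_trans le _; rewrite pM.
Qed.

End UpperBound.

(** * Expansions over the middle digits *)

Section LowerBound.
Context {R : realType}.
Implicit Types (beta x y z : R) (c d e : nat -> nat).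

Lemma expansion_add u v beta d e x y :
  is_expansion u.+1 beta d x -> is_expansion v.+1 beta e y ->
  is_expansion (u + v).+1 beta (fun i => d i + e i)%N (x + y).
Proof.
move=> [du cx] [ev cy]; split.
  by move=> i; rewrite ltnS leq_add// -ltnS.
rewrite (_ : series _ = (series (fun i => (d i)%:R * beta ^- i.+1) \+
    series (fun i => (e i)%:R * beta ^- i.+1))); first exact: cvgD.
apply/funext => n; rewrite /series /= -big_split/=.
by apply: eq_bigr => i _; rewrite natrD mulrDl.
Qed.

Lemma expansion_zero u beta : is_expansion u.+1 beta (fun=> 0%N) 0.
Proof.
split=> //; rewrite (_ : series _ = cst 0); first exact: cvg_cst.
by apply/funext => n; rewrite /series /= big1// => i _; rewrite mul0r.
Qed.

Lemma expansion_constant u beta : 1 < beta ->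
  is_expansion u.+1 beta (fun=> u) (u%:R / (beta - 1)).
Proof.
move=> b1; have := expansion_reflect b1 (expansion_zero u beta).
rewrite subr0 (_ : reflect_seq _ _ = fun=> u)//.
by apply/funext => i; rewrite /reflect_seq /digit_refl /= subn0.
Qed.

Lemma expansion_lt u beta d x m : 1 < beta -> is_expansion u.+1 beta d x ->
  d m != u -> x < u%:R / (beta - 1).
Proof.
move=> b1 dx dm; have [du bd] := (expansionP _ _ _ _ b1).1 dx.
have lt : (d m < u)%N by have := du m; rewrite leq_eqVlt (negbTE dm).
have /andP[_ ub] := bd m.+1; apply: le_lt_trans ub _.
have := psum_tail _ _ _ 0 m b1 du; rewrite psum0 expr0 invr1 !add0r mulr1.
apply: lt_le_trans; rewrite psumS -addrA ltrD2l -mulrDl (exprVn1 _ m)// mulrA.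
by rewrite tail_const_eq// ltr_pM2r ?expVn_gt0// ltrD2r ltr_nat.
Qed.

(** Sequences over the middle digits, ending neither in the largest nor in the
    smallest of them, stay unique in every base [beta >= t.+1], since their
    tails and reflected tails are worth less than [t / (beta - 1) <= 1]. *)
Lemma middle_univoque b t beta d x : (t <= b)%N -> t.+1%:R <= beta -> 1 < beta ->
  (forall i, (b - t <= d i <= t)%N) ->
  (forall n, exists m, d (n + m)%N != t) ->
  (forall n, exists m, d (n + m)%N != (b - t)%N) ->
  is_expansion b.+1 beta d x -> univoque_set b.+1 beta x.
Proof.
move=> tb tbeta b1 mid not_t not_lo dx.
have t1 : t%:R / (beta - 1) <= 1.
  by rewrite ler_pdivrMr; move: tbeta; rewrite -natr1; lra.
have dt : is_expansion t.+1 beta d x.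
  by case: dx => _ cv; split=> // i; have := mid i; lia.
have rt : is_expansion t.+1 beta (reflect_seq b.+1 d) (b%:R / (beta - 1) - x).
  have [_ cv] := expansion_reflect b1 dx; split=> // i.
  by rewrite /reflect_seq /digit_refl /=; have := mid i; lia.
apply: (unique_of_tails_lt1 b beta d x b1 dx) => n.
  have [m dm] := not_t n; apply: lt_le_trans t1.
  exact: (expansion_lt _ _ _ _ m b1 (expansion_shift n b1 dt)).
have [m dm] := not_lo n; apply: lt_le_trans t1.
apply: (expansion_lt _ _ _ _ m b1 (expansion_shift n b1 rt)).
rewrite /shift_seq /reflect_seq /digit_refl /=; apply: contra_neq dm.
by have := mid (n + m)%N; lia.
Qed.

(** In base [beta > a.+1] distinct sequences over the digits up to [a] are
    separated from their first difference on, while in base [a.+1] a common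
    prefix only brings the values close. *)
Lemma change_base_holder a beta c c' y y' z z' (s : R) :
  (0 < a)%N -> a.+1%:R < beta -> 0 <= s -> beta `^ s = a.+1%:R ->
  is_expansion a.+1 a.+1%:R c y -> is_expansion a.+1 a.+1%:R c' y' ->
  is_expansion a.+1 beta c z -> is_expansion a.+1 beta c' z' ->
  `|y - y'| <=
    a.+1%:R * ((1 - a%:R / (beta - 1))^-1) `^ s * `|z - z'| `^ s.
Proof.
move=> a0 ab s0 bs cy cy' cz cz'.
have k1 : 1 < a.+1%:R :> R by rewrite ltr1n.
have b1 : 1 < beta by exact: lt_trans ab.
set gap := 1 - _; have gap0 : 0 < gap.
  by rewrite subr_gt0 ltr_pdivrMr; move: ab; rewrite -natr1; lra.
have K0 : 0 <= a.+1%:R * (gap^-1) `^ s * `|z - z'| `^ s.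
  by rewrite !mulr_ge0 ?powR_ge0.
have [cc|/first_difference[n]] := pselect (c = c').
  by rewrite cc in cy; rewrite (expansion_unique_value cy cy') subrr normr0.
have sep d d' (w w' : R) : is_expansion a.+1 beta d w ->
    is_expansion a.+1 beta d' w' -> (forall i, (i < n)%N -> d i = d' i) ->
    (d n < d' n)%N -> gap * beta ^- n.+1 <= w' - w.
  move=> /(expansionP _ _ _ _ b1)[_ /(_ n.+1)/andP[_ ub]].
  move=> /(expansionP _ _ _ _ b1)[_ /(_ n.+1)/andP[lb _]] eqd lt.
  have := psum_first_difference _ _ _ _ b1 eqd lt.
  rewrite /gap mulrBl mul1r; lra.
move=> ne eqc; have zz : gap * beta ^- n.+1 <= `|z - z'|.
  move: ne; rewrite neq_ltn => /orP[lt|lt].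
    by rewrite distrC (le_trans (sep _ _ _ _ cz cz' eqc lt))// ler_norm.
  apply: le_trans (ler_norm _); apply: (sep _ _ _ _ cz' cz) => // i /eqc; done.
have yy : `|y - y'| <= a.+1%:R ^- n.
  have /(expansionP _ _ _ _ k1)[_ /(_ n)/andP[l1 u1]] := cy.
  have /(expansionP _ _ _ _ k1)[_ /(_ n)/andP[l2 u2]] := cy'.
  have k11 : a%:R / (a.+1%:R - 1) = 1 :> R.
    by rewrite -natr1 addrK divff// pnatr_eq0 -lt0n.
  move: l1 u1 l2 u2; rewrite k11 mul1r (eq_psum _ _ _ _ eqc) => l1 u1 l2 u2.
  by rewrite ler_norml; apply/andP; split; lra.
apply: le_trans yy _; rewrite (exprVn1 _ n)// -mulrA ler_pM2l ?ltr0n//.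
rewrite -bs -powR_expVn// -powRM ?invr_ge0 ?(ltW gap0)//.
apply: ge0_ler_powR => //; rewrite ?nnegrE ?mulr_ge0 ?invr_ge0 ?(ltW gap0)//.
  by rewrite exprn_ge0//; lra.
by rewrite mulrC ler_pdivlMr// mulrC.
Qed.

Definition finite_expansion_points (k : nat) : set R :=
  [set y | exists n m : nat, y = m%:R / k%:R ^+ n].

Lemma finite_expansion_points_countable k : countable (finite_expansion_points k).
Proof.
rewrite (_ : finite_expansion_points k =
    \bigcup_n \bigcup_m [set m%:R / k%:R ^+ n]); last first.
  by apply/seteqP; split=> y [n]; [move=> [m ->]; exists n => //; exists m
    |move=> _ [m _ ->]; exists n, m].
by do 2![apply: bigcup_countable => // ? _]; exact: countable1.
Qed.

Lemma psum_finite_expansion k c n : (0 < k)%N ->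
  exists m : nat, psum (k%:R : R) c n = m%:R / k%:R ^+ n.
Proof.
move=> k0; have kn0 j : k%:R ^+ j != 0 :> R by rewrite expf_neq0// pnatr_eq0 -lt0n.
elim: n => [|n [m IH]]; first by exists 0%N; rewrite psum0 mul0r.
exists (m * k + c n)%N; rewrite psumS IH natrD natrM exprSr.
by rewrite mulrDl -mulf_div divff ?mulr1// pnatr_eq0 -lt0n.
Qed.

(** The two excluded kinds of tails are worth 0 and 1 in base [a.+1]. *)
Lemma finite_expansion_of_constant_tail a c y n u : (0 < a)%N ->
  is_expansion a.+1 a.+1%:R c y -> (forall m, c (n + m)%N = u) ->
  u = 0%N \/ u = a -> finite_expansion_points a.+1 y.
Proof.
move=> a0 cy cu ua; have k1 : 1 < a.+1%:R :> R by rewrite ltr1n.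
have kn0 : a.+1%:R ^+ n != 0 :> R by rewrite expf_neq0// pnatr_eq0.
have tail := expansion_shift n k1 cy.
have [v yv] : exists v : nat, a.+1%:R ^+ n * (y - psum a.+1%:R c n) = v%:R.
  have cE w : u = w -> shift_seq c n = fun=> w.
    by move=> <-; apply/funext => m; exact: cu.
  case: ua => /cE cst; rewrite cst in tail.
    by exists 0%N; exact: (expansion_unique_value tail (expansion_zero a _)).
  exists 1%N; rewrite (expansion_unique_value tail (expansion_constant a _ k1)).
  by rewrite -natr1 addrK divff// pnatr_eq0 -lt0n.
have [m mE] := psum_finite_expansion a.+1 c n isT.
exists n, (m + v)%N; rewrite natrD mulrDl -mE -yv mulrAC divff// mul1r.
by rewrite addrC subrK.
Qed.

(** Digits of an expansion of [y] in base [k = (2 * t - b).+1], raised by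
    [b - t], become middle digits; the constant [b - t] added to every digit
    accounts for the translation of the value in base [beta]. *)
Lemma middle_points_cover b t beta y : (b < 2 * t)%N -> (t < b)%N ->
  t.+1%:R <= beta -> 1 < beta -> 0 <= y <= 1 ->
  ~ finite_expansion_points (2 * t - b).+1 y ->
  exists c z, [/\ is_expansion (2 * t - b).+1 (2 * t - b).+1%:R c y,
    is_expansion (2 * t - b).+1 beta c z &
    univoque_set b.+1 beta ((b - t)%:R / (beta - 1) + z)].
Proof.
move=> bt tb tbeta b1; set a := (2 * t - b)%N => y01 yfin.
have a0 : (0 < a)%N by rewrite /a; lia.
have k1 : 1 < a.+1%:R :> R by rewrite ltr1n.
have [|c cy] := expansion_exists a a.+1%:R y k1 (lexx _).
  by rewrite -natr1 addrK divff// pnatr_eq0 -lt0n.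
have ca i : (c i <= a)%N by case: cy => /(_ i).
have [z cz] := expansion_cvg beta a c b1 ca.
exists c, z; split=> //.
have nonconst u : u = 0%N \/ u = a -> forall n, exists m, c (n + m)%N != u.
  move=> ua n; apply: contrapT => H; apply: yfin.
  apply: (finite_expansion_of_constant_tail _ _ _ n u a0 cy _ ua) => m.
  by apply/eqP/negPn/negP => cm; apply: H; exists m.
apply: (middle_univoque b t beta (fun i => (b - t) + c i)%N) => //.
- exact: ltnW.
- by move=> i; have := ca i; rewrite /a; lia.
- move=> n; have [m cm] := nonconst a (or_intror erefl) n.
  by exists m; move: cm; rewrite /a; lia.
- move=> n; have [m cm] := nonconst 0%N (or_introl erefl) n.
  by exists m; move: cm; lia.
- apply: (@expansion_widen _ ((b - t) + a)); first by rewrite /a; lia.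
  by apply: expansion_add => //; exact: expansion_constant.
Qed.

End LowerBound.

(** * Lower bound for the dimension *)

Section HausdorffLowerBound.
Context {R : realType}.
Local Open Scope ereal_scope.

Lemma hausdorff_measure0_cover (s delta e : R) (A : set R) :
  (0 < delta)%R -> (0 < e)%R -> hausdorff_measure s A = 0 ->
  exists F : nat -> set R, [/\ A `<=` \bigcup_i F i,
    forall i, diameter (F i) <= delta%:E &
    \sum_(0 <= i <oo) diameter_pow s (F i) < e%:E].
Proof.
move=> d0 e0 A0; have : hausdorff_premeasure s delta A < e%:E.
  apply: (@le_lt_trans _ _ (hausdorff_measure s A)); last by rewrite A0 lte_fin.
  by apply: ereal_sup_ubound; exists delta.
by move=> /ereal_inf_lt[_ [F [AF dF] <-] lt]; exists F.
Qed.

Lemma dist_le_diameter (A : set R) (x y rho : R) : A x -> A y ->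
  diameter A <= rho%:E -> (`|x - y| <= rho)%R.
Proof.
move=> Ax Ay dA; rewrite -lee_fin; apply: le_trans dA.
by apply: ereal_sup_ubound; exists x => //; exists y.
Qed.

(** A pair of correspondences [Z], [Y] that is Holder of exponent [s0] cannot
    send a set of zero [s]-dimensional measure, [s <= s0], onto the unit
    interval up to a countable set: the images of a cheap cover would be
    intervals of small total length. *)
Lemma holder_cover_measure_neq0 (I : Type) (Y Z : I -> R -> Prop) (shift K s0 s : R)
    (U Q : set R) :
  (0 < K)%R -> (0 < s0)%R -> (s <= s0)%R -> countable Q ->
  (forall c c' y y' z z', Y c y -> Y c' y' -> Z c z -> Z c' z' ->
    (`|y - y'| <= K * `|z - z'| `^ s0)%R) ->
  (forall y : R, (0 <= y <= 1)%R -> ~ Q y ->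
    exists c z, [/\ Y c y, Z c z & U (shift + z)%R]) ->
  hausdorff_measure s U <> 0.
Proof.
move=> K0 s00 ss0 cQ holder cov U0.
have e0 : (0 < (2 * K)^-1 :> R)%R by rewrite invr_gt0 mulr_gt0.
have [F [UF dF sumF]] := hausdorff_measure0_cover s 1 _ U ltr01 e0 U0.
pose G i y := exists c z, [/\ Y c y, Z c z & F i (shift + z)%R].
have /choice[J JP] : forall i, exists J : set R, [/\ measurable J, G i `<=` J &
    lebesgue_measure J <= (2 * K)%:E * diameter_pow s (F i)].
  move=> i; have [[g Gg]|noG] := pselect (exists g, G i g); last first.
    exists set0; split=> //; first by move=> y Gy; apply: noG; exists y.
    by rewrite measure0 mule_ge0 ?diameter_pow_ge0// lee_fin mulr_ge0// ltW.
  have [c [z [Yc Zc Fz]]] := Gg.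
  have Fi0 : F i !=set0 by exists (shift + z)%R.
  have [rho rhoE rho01] : exists2 rho : R, diameter (F i) = rho%:E & (0 <= rho <= 1)%R.
    have := dF i; have := diameter_ge0 _ Fi0.
    case: (diameter (F i)) => [rho|//|//]; rewrite !lee_fin => h0 h1.
    by exists rho => //; rewrite h0.
  have /andP[rho0 rho1] := rho01.
  pose r := (K * rho `^ s0)%R; have r0 : (0 <= r)%R.
    by rewrite mulr_ge0 ?powR_ge0// ltW.
  exists [set` `[g - r, g + r]%R]; split; first exact: measurable_itv.
    move=> y [c' [z' [Yc' Zc' Fz']]]; rewrite /= in_itv /=.
    have : (`|y - g| <= r)%R.
      apply: le_trans (holder _ _ _ _ _ _ Yc' Yc Zc' Zc) _.
      rewrite ler_pM2l//; apply: ge0_ler_powR; rewrite ?nnegrE ?(ltW s00)//.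
      have -> : (z' - z = (shift + z') - (shift + z))%R by ring.
      by apply: (dist_le_diameter _ _ _ _ Fz' Fz); rewrite rhoE.
    by rewrite ler_norml => /andP[h1 h2]; apply/andP; split; lra.
  have -> : diameter_pow s (F i) = (rho `^ s)%R%:E.
    by rewrite /diameter_pow ifN ?rhoE//; exact/set0P.
  rewrite lebesgue_measure_itv /=.
  apply: (@le_trans _ _ (2 * r)%:E).
    case: ifP => _; last by rewrite lee_fin mulr_ge0.
    by rewrite -EFinB lee_fin; lra.
  rewrite -EFinM lee_fin /r mulrA ler_pM2l ?mulr_gt0//.
  move: rho0; rewrite le_eqVlt => /predU1P[<-|rhop].
    by rewrite powR0 ?gt_eqF// powR_ge0.
  by apply: ger_powR => //; rewrite rhop.
have mQ : measurable Q by apply: countable_measurable => // y; exact: measurable_set1.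
have Q0 : lebesgue_measure Q <= 0 by rewrite countable_lebesgue_measure0.
have : lebesgue_measure ([set` `[0, 1]%R] : set R) <=
    \sum_(0 <= i <oo) lebesgue_measure (J i `|` Q).
  apply: measure_sigma_subadditive.
  - by move=> i; apply: measurableU => //; have [] := JP i.
  - exact: measurable_itv.
  - move=> y /=; rewrite in_itv /= => y01.
    have [Qy|nQ] := pselect (Q y); first by exists 0%N => //; right.
    have [c [z [Yc Zc Uz]]] := cov y y01 nQ.
    have [i _ Fi] := UF _ Uz; exists i => //; left.
    by have [_ sub _] := JP i; apply: sub; exists c, z.
rewrite lebesgue_measure_itv /= lte_fin ltr01 -EFinB subr0.
apply/negP; rewrite -ltNge.
apply: (@le_lt_trans _ _ ((2 * K)%:E * \sum_(0 <= i <oo) diameter_pow s (F i))).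
  rewrite -nneseriesZl; last by move=> ? _; exact: diameter_pow_ge0.
  apply: lee_nneseries => // i _; have [mJ _ le] := JP i.
  apply: le_trans (measureU2 lebesgue_measure mJ mQ) _.
  by rewrite -[leRHS]adde0; apply: leeD.
have twoK : (0 < 2 * K)%R by rewrite mulr_gt0.
rewrite (_ : 1%R%:E = (2 * K)%:E * ((2 * K)^-1)%:E); last first.
  by rewrite -EFinM divff// gt_eqF.
by rewrite lte_pmul2l// lte_fin.
Qed.

End HausdorffLowerBound.

(** Partial sums below 1 give [t / (beta - 1) <= 1]; since [t.+1] is still a
    digit, its rejection at every place gives the converse inequality. *)
Lemma quasi_greedy_constant_base {R : realType} b t (beta : R) : (t < b)%N ->
  1 < beta -> quasi_greedy b.+1 beta =1 (fun=> t) -> beta = t.+1%:R.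
Proof.
move=> tb b1 /funext qg.
have psumE n : psum beta (quasi_greedy b.+1 beta) n =
    t%:R / (beta - 1) * (1 - beta ^- n).
  have := psum_reflect t beta (fun=> 0%N) n b1 (fun=> leq0n t).
  rewrite qg (_ : reflect_seq t.+1 _ = fun=> t); last first.
    by apply/funext => i; rewrite /reflect_seq /digit_refl /= subn0.
  by move=> ->; rewrite /psum big1 ?subr0// => i _; rewrite mul0r.
have spec := @quasi_greedy_spec R b.+1 beta isT.
have cvg_to1 : t%:R / (beta - 1) = 1.
  apply/eqP; rewrite eq_le; apply/andP; split.
    rewrite leNgt; apply/negP => gt.
    have q01 : 0 <= beta^-1 < 1 by rewrite invr_ge0 invf_lt1; lra.
    have [j lt] := geometric_lt (t%:R / (beta - 1)) _ (t%:R / (beta - 1) - 1)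
      q01 ltac:(lra).
    have [_ + _] := spec j; rewrite -/(psum beta _ j.+1) psumE.
    move: lt; rewrite exprVn => lt; rewrite mulrBr mulr1.
    have : t%:R / (beta - 1) * beta ^- j.+1 <= t%:R / (beta - 1) * beta ^- j.
      rewrite ler_wpM2l ?tail_const_ge0// (exprVn1 _ j)// ler_peMl ?ltW//.
      exact: expVn_gt0.
    lra.
  rewrite leNgt; apply/negP => lt1.
  have q01 : 0 <= beta^-1 < 1 by rewrite invr_ge0 invf_lt1; lra.
  have [j] := geometric_lt 1 _ (1 - t%:R / (beta - 1)) q01 ltac:(lra).
  rewrite mul1r exprVn => lt.
  have [_ _ /(_ t.+1 tb)] := spec j; rewrite qg ltnn => H.
  suff : false by []; apply: H; rewrite -/(psum beta _ j) -qg psumE.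
  have bj0 : 0 < beta ^- j := expVn_gt0 _ j b1.
  have bS : t.+1%:R * beta ^- j.+1 <= t%:R / (beta - 1) * beta ^- j + beta ^- j.
    rewrite (exprVn1 _ j)// -natr1 mulrDl mul1r; apply: lerD.
      rewrite mulrA ler_pM2r ?expVn_gt0// tail_const_eq// lerDl.
      exact: tail_const_ge0.
    by rewrite ler_peMl ?ltW// expVn_gt0.
  by rewrite mulrBr mulr1; lra.
have bn0 : beta - 1 != 0 by lra.
move: cvg_to1 => /(congr1 ( *%R^~ (beta - 1))); rewrite mulfVK// mul1r.
by rewrite -natr1 => ->; rewrite subrK.
Qed.

Lemma hausdorff_dim_ge {R : realType} (A : set R) (s0 : R) :
  (forall s, 0 <= s < s0 -> hausdorff_measure s A <> 0%E) ->
  (s0%:E <= hausdorff_dim A)%E.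
Proof.
move=> H; apply: le_ereal_inf_tmp => _ [s [s_ge0 s_null] <-].
by rewrite lee_fin leNgt; apply/negP => lt; apply: (H s); rewrite ?s_ge0.
Qed.

Lemma univoque_dim_ge {R : realType} b t (beta : R) : (b - t <= t)%N ->
  (t < b)%N -> t.+1%:R <= beta -> 1 < beta ->
  ((ln (2 * t + 1 - b)%:R / ln beta)%:E <=
   hausdorff_dim (univoque_set b.+1 beta))%E.
Proof.
move=> bt tb tbeta b1.
(* With a single middle digit the claimed dimension is 0. *)
have [k1|k1] := leqP (2 * t + 1 - b)%N 1.
  have -> : (2 * t + 1 - b = 1)%N by lia.
  rewrite ln1 mul0r; apply: hausdorff_dim_ge => s.
  by move=> /andP[/le_lt_trans H /H]; rewrite ltxx.
pose a := (2 * t - b)%N; have ka : (2 * t + 1 - b = a.+1)%N by rewrite /a; lia.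
have ab : a.+1%:R < beta by apply: lt_le_trans tbeta; rewrite ltr_nat /a; lia.
have s0 : 0 < ln a.+1%:R / ln beta.
  by rewrite divr_gt0// ln_gt0// ltr1n; rewrite /a; lia.
rewrite ka; apply: hausdorff_dim_ge => s /andP[_ ss0].
have a0 : (0 < a)%N by rewrite /a; lia.
have gap0 : 0 < 1 - a%:R / (beta - 1).
  by rewrite subr_gt0 ltr_pdivrMr; move: ab; rewrite -natr1; lra.
apply: (@holder_cover_measure_neq0 R (nat -> nat)
  (is_expansion a.+1 a.+1%:R) (is_expansion a.+1 beta) ((b - t)%:R / (beta - 1))
  (a.+1%:R * ((1 - a%:R / (beta - 1))^-1) `^ (ln a.+1%:R / ln beta))
  _ s _ (finite_expansion_points a.+1) _ s0 (ltW ss0)).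
- by rewrite mulr_gt0// powR_gt0// invr_gt0.
- exact: finite_expansion_points_countable.
- move=> c c' y y' z z'; apply: change_base_holder => //; first exact: ltW.
  exact: powR_log_base.
- move=> y y01 ny; apply: (middle_points_cover b t) => //; lia.
Qed.

(** The quasi-greedy hypothesis at [betaU] also shows that [theta] consists of
    digits. *)
Lemma univoque_dim_le {R : realType} b t (beta betaU : R) :
  (b - t <= t)%N -> (0 < t < b)%N ->
  quasi_greedy b.+1 betaU =1 thue_morse b.+1 [:: t.+1] ->
  1 < beta -> beta <= betaU -> betaU <= b.+1%:R ->
  (hausdorff_dim (univoque_set b.+1 beta) <=
   (ln (2 * t + 1 - b)%:R / ln beta)%:E)%E.
Proof.
move=> bt t0b qg b1 bU UN.
have s0 : 0 <= ln (2 * t + 1 - b)%:R / ln beta by apply: log_base_ge0 => //; lia.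
apply: hausdorff_dim_le => // s lt; apply: hausdorff_measure_eq0.
  exact: le_lt_trans lt.
apply: (univoque_content0 b t beta betaU) => // i.
by rewrite -qg -ltnS; have [] := @quasi_greedy_spec R b.+1 betaU isT i.
Qed.

Theorem theorem7p1 (R : realType) (N : nat) (hN : (3 <= N)%N) (t1 : nat)
    (betaL betaU : R) (h : admissible_interval N [:: t1] betaL betaU) :
  (uphalf N.-1 <= t1 <= N - 2)%N /\
  forall beta : R, betaL <= beta <= betaU ->
    hausdorff_dim (univoque_set N beta) =
      (ln ((2 * t1 + 2)%:R - N%:R) / ln beta)%:E.
Proof.
case: h => -[_ _ lastlt /(_ 0%N isT)[refl_le _]] /andP[L1 LN] /andP[U1 UN] qgL qgU.
case: N hN lastlt refl_le LN UN qgL qgU => // b b2 /= tb refl_le LN UN qgL qgU.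
have bt : (b - t1 <= t1)%N.
  by move: refl_le; rewrite /block_le Order.SeqLexiOrder.lexi_cons => /andP[].
have t0 : (0 < t1)%N by lia.
split; first by rewrite uphalfE; apply/andP; split; lia.
move=> beta /andP[Lb bU].
have b1 : 1 < beta by exact: lt_le_trans Lb.
have LE : betaL = t1.+1%:R.
  apply: (quasi_greedy_constant_base b) => // i.
  by rewrite qgL /Defs.periodic modn1.
have -> : (2 * t1 + 2)%:R - b.+1%:R = (2 * t1 + 1 - b)%:R :> R.
  by rewrite -natrB; [congr (_%:R)|]; lia.
apply/eqP; rewrite eq_le; apply/andP; split.
  by apply: (univoque_dim_le b t1 beta betaU) => //; rewrite t0.
by apply: univoque_dim_ge => //; rewrite -LE.
Qed.
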